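(* Let $Q$ be a quantale, let $\Sigma_Q$ be a class of proper ideals of $Q$, and let $\mathcal M(\Sigma_Q)$ denote the set of maximal elements of $\Sigma_Q$ (with respect to inclusion). Then the following are equivalent: (1) the quantale space $\Sigma_Q$ is quasi-compact; (2) for every $I\in\Sigma_Q$ there exists $J\in\mathcal M(\Sigma_Q)$ such that $I\subseteq J$, and the quantale space $\mathcal M(\Sigma_Q)$ is quasi-compact.
   Context: A quantale here means a complete lattice $(Q,\preccurlyeq,\bot,\top)$ with a binary operation $\&$ that is associative, commutative, satisfies $x\&\bigl(\bigvee_{\lambda} y_\lambda\bigr)=\bigvee_\lambda (x\& y_\lambda)$ for all families, and satisfies $x\&\top=x$ for all $x$. An ideal of $Q$ is a nonempty subset $I\subseteq Q$ such that $x,y\in I$ implies $x\vee y\in I$, and $x\in I$, $l\preccurlyeq x$ imply $l\in I$. $\mathcal I_Q$ is the set of all ideals of $Q$. An ideal is proper if $I\neq Q$. For a set $\Sigma_Q$ of proper ideals of $Q$ and $X\subseteq \mathcal I_Q$, put $X^{\uparrow}=\{J\in\Sigma_Q\mid \bigcap X\subseteq J\}$ if $X\neq\emptyset$ and $\emptyset^{\uparrow}=\emptyset$. The quantale topology on $\Sigma_Q$ is the topology having the sets $X^{\uparrow}$ ($X\subseteq \mathcal I_Q$) as a subbasis of closed sets; $\Sigma_Q$ with this topology is called a quantale space. (The quantale topology on a subset of $\Sigma_Q$ is the subspace topology.) A space is quasi-compact if every open cover has a finite subcover (no Hausdorff assumption). *)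

(* Defs.v *)
From HB Require Import structures.
From mathcomp Require Export all_boot all_order.
From mathcomp Require Export mathcomp_extra boolp classical_sets functions topology.

Set Implicit Arguments.
Unset Strict Implicit.
Unset Printing Implicit Defensive.

Local Open Scope classical_set_scope.

(* The order determines the binary joins, \bot and \top of a lattice, so
   completeness only adds the existence of arbitrary joins. *)
HB.mixin Record isCompleteLattice (d : Order.disp_t) Q
    of Order.TBLattice d Q := {
  bigjoin : set Q -> Q;
  bigjoin_isLub : forall A : set Q, isLub A (bigjoin A)
}.

#[short(type="completeLatticeType")]
HB.structure Definition CompleteLattice (d : Order.disp_t) :=
  { Q of isCompleteLattice d Q & Order.TBLattice d Q }.

HB.mixin Record isQuantale (d : Order.disp_t) Q of CompleteLattice d Q := {
  qmul : Q -> Q -> Q;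
  qmulA : associative qmul;
  qmulC : commutative qmul;
  qmul_bigjoinr : forall (x : Q) (A : set Q),
    qmul x (bigjoin A) = bigjoin [set qmul x y | y in A];
  qmulx1 : right_id (Order.top : Q) qmul
}.

#[short(type="quantaleType")]
HB.structure Definition Quantale (d : Order.disp_t) :=
  { Q of isQuantale d Q & CompleteLattice d Q }.

Section QuantaleSpace.
Variables (d : Order.disp_t) (Q : quantaleType d).

Definition is_ideal (I : set Q) : Prop :=
  [/\ I !=set0,
      forall x y, I x -> I y -> I (Order.join x y)
    & forall x l, I x -> (l <= x)%O -> I l].

Definition is_proper_ideal (I : set Q) : Prop := is_ideal I /\ I <> setT.

(* An alias of [set_type S], so that its topology is the quantale topology and
   not the one [set_type S] might inherit from a topology on [set Q]. *)
Definition quantale_space (S : set (set Q)) : Type := set_type S.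

HB.instance Definition _ (S : set (set Q)) :=
  gen_eqMixin (quantale_space S).

HB.instance Definition _ (S : set (set Q)) :=
  gen_choiceMixin (quantale_space S).

Definition ideal_of (S : set (set Q)) (J : quantale_space S) : set Q :=
  val J.

(* The condition [X !=set0] encodes the convention that the hull of the empty
   family is empty (rather than the intersection over it being [setT]). *)
Definition hull (S : set (set Q)) (X : set (set Q)) : set (quantale_space S) :=
  [set J | X !=set0 /\ \bigcap_(I in X) I `<=` ideal_of J].
Arguments hull S X : clear implicits.

(* The complements of a subbasis of closed sets form a subbasis of open sets. *)
HB.instance Definition _ (S : set (set Q)) :=
  isSubBaseTopological.Build (quantale_space S)
    [set X : set (set Q) | X `<=` is_ideal] (fun X => ~` hull S X).

Definition maximal_ideals (S : set (set Q)) : set (quantale_space S) :=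
  [set I | forall J : quantale_space S, ideal_of I `<=` ideal_of J -> J = I].

End QuantaleSpace.

Arguments hull {d Q} S X _.
Arguments maximal_ideals {d Q} S _.

(* [compact] is avoided because it is phrased through filters, whereas
   [cover_compact] is the open-cover definition. *)
Definition quasi_compact_space (T : topologicalType) : Prop :=
  cover_compact [set: T].

(* Main.v *)
Require Import Defs.

Local Open Scope classical_set_scope.

(* Closed sets of a quantale space are closed under passing to larger ideals,
   so an open set containing J contains every I below J: once every ideal lies
   below a maximal one, open covers of the maximal ideals and of the whole space
   are the same thing. Quasi-compactness provides the maximal ideals by Zorn's
   lemma: for a chain A, the closed sets {J | I `<=` J}, I in A, have the finite
   intersection property, and a common point of all of them bounds A. *)

(** Induction on [s], keeping the larger of the new element and the bound so far; a point of [A]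
    serves the empty list. *)
Lemma total_on_seq_ub (T : eqType) (R : T -> T -> Prop) (A : set T)
    (s : seq T) :
  (forall x, R x x) -> (forall x y z, R x y -> R y z -> R x z) ->
  A !=set0 -> total_on A R -> {in s, forall x, A x} ->
  exists2 y, A y & {in s, forall x, R x y}.
Proof.
move=> Rxx Rtr [a0 Aa0] Atot; elim: s => [|a s IHs] sA; first by exists a0.
have [x xs|y Ay sy] := IHs; first by apply: sA; rewrite inE xs orbT.
have Aa : A a by apply: sA; rewrite mem_head.
have [ay|ya] := Atot _ _ Aa Ay.
  by exists y => // x; rewrite inE => /predU1P[->|/sy].
exists a => // x; rewrite inE => /predU1P[->|/sy xy]; first exact: Rxx.
exact: Rtr xy ya.
Qed.

Section QuantaleSpaceTheory.
Variables (d : Order.disp_t) (Q : quantaleType d) (S : set (set Q)).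
Implicit Types I J K : quantale_space S.

Lemma open_quantaleE :
  open = [set \bigcup_(V in B) V | B in
           subset^~ (finI_from [set X : set (set Q) | X `<=` is_ideal (Q := Q)]
                               (fun X => ~` hull S X))].
Proof. by []. Qed.

Lemma open_hullC (X : set (set Q)) :
  X `<=` is_ideal (Q := Q) -> open (~` hull S X).
Proof.
move=> Xideal; rewrite open_quantaleE.
exists [set ~` hull S X]; last exact: bigcup_set1.
by move=> _ ->; exact: finI_from1.
Qed.

(** Complements of hulls are closed under passing to smaller ideals, and finite intersections and
    unions preserve this. *)
Lemma open_quantale_down (U : set (quantale_space S)) I J :
  open U -> ideal_of I `<=` ideal_of J -> U J -> U I.
Proof.
rewrite open_quantaleE => -[B sB <-] IJ [V BV VJ]; exists V => //.
have [F _ VE] := sB _ BV; move: VJ; rewrite -VE => VJ X FX [X0 XI].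
by apply: (VJ X FX); split=> //; exact: subset_trans XI IJ.
Qed.

Lemma quasi_compact_chain_ub (A : set (quantale_space S)) :
  S `<=` is_ideal (Q := Q) -> quasi_compact_space (quantale_space S) ->
  A !=set0 -> total_on A (fun I J => ideal_of I `<=` ideal_of J) ->
  exists K, forall I, A I -> ideal_of I `<=` ideal_of K.
Proof.
move=> Sideal cS A0 Atot; apply: contrapT => noub.
have hull1 I K : hull S [set ideal_of I] K <-> ideal_of I `<=` ideal_of K.
  by rewrite /hull /= bigcap_set1; split=> [[]//|]; split=> //; exists (ideal_of I).
have openA I : A I -> open (~` hull S [set ideal_of I]).
  by move=> _; apply: open_hullC => _ ->; exact: Sideal (set_valP I).
(* A point outside all these open sets would bound [A], so they cover the space. *)
have [K _|F FA covF] := cS _ A _ openA.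
  apply: contrapT => nK; apply: noub; exists K => I AI.
  by apply/hull1; apply: contrapT => nIK; apply: nK; exists I.
(* A bound [K] of the finite subfamily [F] lies in all its hulls, so the subcover misses [K]. *)
have [||K AK FK] := @total_on_seq_ub _ _ _ (finmap.enum_fset F)
    (fun I => @subset_refl _ (ideal_of I)) _ A0 Atot.
- by move=> I J K; exact: subset_trans.
- by move=> I /FA; rewrite inE.
have [I FI] := covF K Logic.I; apply; apply/hull1; exact: FK.
Qed.

Lemma quasi_compact_le_maximal I :
  S `<=` is_ideal (Q := Q) -> quasi_compact_space (quantale_space S) ->
  exists2 J, maximal_ideals S J & ideal_of I `<=` ideal_of J.
Proof.
move=> Sideal cS.
(* Zorn's lemma is applied only above [I]; what is maximal there is maximal in [S], since anything
   larger still contains [I]. *)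
pose T := {J : quantale_space S | ideal_of I `<=` ideal_of J}.
pose R (x y : T) := `[< ideal_of (sval x) `<=` ideal_of (sval y) >].
have Rxx x : R x x by apply/asboolP.
have Rtr x y z : R x y -> R y z -> R x z.
  by move=> /asboolP xy /asboolP yz; apply/asboolP; exact: subset_trans xy yz.
pose t0 : T := exist _ I (@subset_refl _ _).
have [A Atot|[J IJ] Jmax] := ZL_preorder t0 Rxx Rtr.
  have [->|/set0P[J0 AJ0]] := eqVneq A set0.
    by exists t0.
  have [||K Kub] := @quasi_compact_chain_ub (@sval _ _ @` A) Sideal cS.
  - by exists (sval J0), J0.
  - move=> _ _ [J AJ <-] [K AK <-].
    by have [/asboolP|/asboolP] := Atot J K AJ AK; [left|right].
  have IK : ideal_of I `<=` ideal_of K.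
    by apply: subset_trans (svalP J0) (Kub _ _); exists J0.
  by exists (exist _ K IK) => J AJ; apply/asboolP/Kub; exists J.
exists J => // K JK; apply: val_inj; apply/seteqP; split=> //.
have IK := subset_trans IJ JK.
by apply/asboolP; apply: (Jmax (exist _ K IK)); apply/asboolP.
Qed.

End QuantaleSpaceTheory.

(* [maximal_ideals S], a set of points of [quantale_space S], is coerced to its
   subtype, which carries the subspace topology. *)
Theorem proposition4p4 (d : Order.disp_t) (Q : quantaleType d)
    (S : set (set Q)) (properS : S `<=` is_proper_ideal (Q := Q)) :
  quasi_compact_space (quantale_space S) <->
  (forall I : quantale_space S,
      exists2 J : quantale_space S,
        maximal_ideals S J & ideal_of I `<=` ideal_of J) /\
  quasi_compact_space (set_type (maximal_ideals S)).
Proof.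
split=> [cS|[maxS cM] L D f fopen fcov].
  have Sideal : S `<=` is_ideal (Q := Q) by move=> I /properS[].
  have maxS I := @quasi_compact_le_maximal _ _ _ I Sideal cS.
  split=> // L D f fopen fcov.
  (* Each member of the cover is the trace of an open set [g i] of the whole space; outside [D] the
     value is arbitrary. *)
  have /choice[g gP] i : exists V : set (quantale_space S),
      D i -> open V /\ set_val @^-1` V = f i.
    have [/fopen[V oV VE]|nDi] := pselect (D i); first by exists V.
    by exists set0.
  have [i /gP[]//|I _|F FD covF] := cS L D g.
    have [J Jmax IJ] := maxS I.
    have [i Di fiJ] := fcov (SigSub (mem_set Jmax)) Logic.I.
    have [gopen gE] := gP i Di; exists i => //.
    by apply: open_quantale_down gopen IJ _; rewrite -gE in fiJ.
  exists F => // J _; have [i Fi giJ] := covF (set_val J) Logic.I.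
  exists i => //; have /set_mem Di := FD i Fi.
  by have [_ <-] := gP i Di.
(* Conversely, the cover is restricted to the maximal ideals; a finite subcover there already covers
   every ideal below them. *)
have [i Di|J _|F FD covF] := cM L D (fun i => set_val @^-1` f i).
- by exists (f i) => //; exact: fopen.
- by have [i Di fiJ] := fcov (set_val J) Logic.I; exists i.
exists F => // I _; have [J Jmax IJ] := maxS I.
have [i Fi fiJ] := covF (SigSub (mem_set Jmax)) Logic.I.
have /set_mem Di := FD i Fi.
by exists i => //; exact: open_quantale_down (fopen i Di) IJ fiJ.
Qed.
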